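(* Let $a\ge0$. For every function $F:[0,\infty)\to(0,1)$ that strictly decreases to zero and satisfies $\{1/(j+1)\mid j\in\mathbb N\setminus\{0\}\}\subseteq\mathrm{range}(F)$, there is a point $z^0\in\ell_2^2(\mathbb N)$ and two closed subspaces $U$ and $V$ of $\ell_2^2(\mathbb N)$ with zero intersection, $U\cap V=\{0\}$, such that the FDRS sequence $(z^j)_{j\ge0}$ generated from $z^0$ with the functions $f:=\chi_U+(a/2)\|\cdot\|^2$ and $g:=(1/2)\|\cdot\|^2$, the subspace $V$, and parameters $\lambda_k\equiv1$ and $\gamma=1$, strongly converges to zero, but for all $k\ge1$, $$\|z^k-z^*\|\ge e^{-1}F(k),$$ where $z^*=0$ is the fixed point of the FDRS operator $T$.
   Context: $\ell_2^2(\mathbb N)=\mathbb R^2\oplus\mathbb R^2\oplus\cdots$ is the Hilbert space of square-summable sequences of vectors in $\mathbb R^2$. $\chi_C$ denotes the indicator function of a set $C$ ($0$ on $C$, $+\infty$ elsewhere). For a Hilbert space $\mathcal H$ with identity $I$, a closed subspace $V$ with orthogonal projection $P_V$, a closed proper convex $f:\mathcal H\to(-\infty,\infty]$, a differentiable convex $g:\mathcal H\to\mathbb R$ and $\gamma>0$: $\mathrm{prox}_{\gamma f}(x):=\arg\min_y\left(f(y)+\frac1{2\gamma}\|y-x\|^2\right)$, $\mathrm{refl}_{\gamma f}:=2\,\mathrm{prox}_{\gamma f}-I$, $\mathrm{refl}_{\chi_V}:=2P_V-I$, and the FDRS operator is $T:=\left(\frac12I+\frac12\mathrm{refl}_{\gamma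 f}\circ\mathrm{refl}_{\chi_V}\right)\circ(I-\gamma P_V\circ\nabla g\circ P_V)$. The FDRS sequence from $z^0$ with relaxation parameters $(\lambda_k)$ is $z^{k+1}=(1-\lambda_k)z^k+\lambda_kTz^k$; for $\lambda_k\equiv1$ this is $z^{k+1}=Tz^k$. *)

(* Defs.v *)
From HB Require Import structures.
From mathcomp Require Import all_boot all_order all_algebra.
From mathcomp Require Import all_classical all_reals all_analysis.
From mathcomp Require Import ring lra.

Set Implicit Arguments.
Unset Strict Implicit.
Unset Printing Implicit Defensive.

Import Order.TTheory GRing.Theory Num.Theory.
Import numFieldNormedType.Exports.

Local Open Scope classical_set_scope.
Local Open Scope ring_scope.

HB.mixin Record NormedModule_isInnerProduct (R : realType) H
    & NormedModule R H := {
  inner : {dot H for idfun};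
  inner_norm : forall x : H, inner x x = `|x| ^+ 2
}.

#[short(type="innerProductType")]
HB.structure Definition InnerProduct (R : realType) :=
  {H of NormedModule_isInnerProduct R H & NormedModule R H}.

#[short(type="hilbertType")]
HB.structure Definition Hilbert (R : realType) :=
  {H of InnerProduct R H & CompleteNormedModule R H}.

Section FDRS.
Context (R : realType) (H : hilbertType R).
Implicit Types (V C : set H) (f : H -> \bar R) (g : H -> R) (x z : H).

Definition closed_subspace V : Prop := closed V /\ submod_closed [in V].

Definition chi C x : \bar R := if x \in C then 0%E else +oo%E.

(* [get A] is a chosen element of A when A is nonempty. The sets below are
   singletons when V is a closed subspace, f is closed, convex and proper,
   gamma > 0 and g is differentiable at x. *)
Definition proj V x : H :=
  get [set p | V p /\ forall v, V v -> inner (x - p) v = 0].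

Definition prox (gamma : R) f x : H :=
  get [set y | forall y', (f y + ((2 * gamma)^-1 * `|y - x| ^+ 2)%:E <=
                           f y' + ((2 * gamma)^-1 * `|y' - x| ^+ 2)%:E)%E].

Definition grad g x : H :=
  get [set v | differentiable g x /\ forall h, 'd g x h = inner v h].

Definition refl_prox (gamma : R) f x : H := 2 *: prox gamma f x - x.

Definition refl_proj V x : H := 2 *: proj V x - x.

Definition fdrs_op (gamma : R) f g V z : H :=
  let w := z - gamma *: proj V (grad g (proj V z)) in
  2^-1 *: w + 2^-1 *: refl_prox gamma f (refl_proj V w).

Fixpoint fdrs_seq (gamma : R) f g V (lambda : nat -> R) z (k : nat) : H :=
  if k is k'.+1 then
    let zk := fdrs_seq gamma f g V lambda z k' in
    (1 - lambda k') *: zk + lambda k' *: fdrs_op gamma f g V zk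
  else z.

End FDRS.

Section SquareSummable.
Context (R : realType).
Implicit Types (u v w : 'rV[R]_2) (x y z : nat -> 'rV[R]_2).

(* The library norm on row vectors is the sup norm, hence the Euclidean
   structure of R^2 is spelled out. *)
Definition dotv u v : R := \sum_(i < 2) u 0 i * v 0 i.

Lemma dotvC u v : dotv u v = dotv v u.
Proof. by apply: eq_bigr => i _; rewrite mulrC. Qed.

Lemma dotvP (a : R) u v w : dotv (a *: u + v) w = a * dotv u w + dotv v w.
Proof.
rewrite /dotv mulr_sumr -big_split.
by apply: eq_bigr => i _; rewrite !mxE /=; ring.
Qed.

Lemma dotv_ge0 u : 0 <= dotv u u.
Proof. by apply: sumr_ge0 => i _; rewrite -expr2 sqr_ge0. Qed.

Lemma dotv_coord u i : u 0 i ^+ 2 <= dotv u u.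
Proof.
rewrite /dotv (bigD1 i) //= -expr2 lerDl; apply: sumr_ge0 => j _.
by rewrite -expr2 sqr_ge0.
Qed.

Lemma dotv_eq0 u : dotv u u = 0 -> u = 0.
Proof.
move=> u0; apply/rowP => i; rewrite mxE; apply/eqP.
by rewrite -sqrf_eq0 eq_le sqr_ge0 andbT -u0 dotv_coord.
Qed.

Lemma dotv_le u v : `|dotv u v| <= dotv u u + dotv v v.
Proof.
rewrite /dotv -big_split; apply: (le_trans (ler_norm_sum _ _ _)).
apply: ler_sum => i _ /=; rewrite ler_norml.
move: (u 0 i) (v 0 i) => a b; apply/andP; split; nra.
Qed.

Definition sqsum x := cvgn (series (fun n => dotv (x n) (x n))).

Lemma sqsum_dotv x y : sqsum x -> sqsum y ->
  cvgn (series (fun n => dotv (x n) (y n))).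
Proof.
move=> xs ys; apply: normed_cvg.
apply: (@series_le_cvg R _ (fun n => dotv (x n) (x n) + dotv (y n) (y n))).
- by move=> n; exact: normr_ge0.
- by move=> n; rewrite addr_ge0 ?dotv_ge0.
- by move=> n; exact: dotv_le.
- exact: is_cvg_seriesD.
Qed.

Lemma sqsum_submod : submod_closed [pred x : nat -> 'rV[R]_2 | `[< sqsum x >]].
Proof.
split=> [|a x y /asboolP xs /asboolP ys]; apply/asboolP.
  rewrite /sqsum (_ : (fun _ => _) = fun=> 0); last first.
    by apply/funext => n; rewrite /dotv big1 // => i _; rewrite mxE mul0r.
  rewrite /series /= (_ : (fun _ => _) = fun=> 0); first exact: is_cvg_cst.
  by apply/funext => n; rewrite big1.
rewrite /sqsum.
have -> : (fun n => dotv ((a *: x + y) n) ((a *: x + y) n)) =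
    (a ^+ 2 *: (fun n => dotv (x n) (x n)) +
     (2 * a) *: (fun n => dotv (x n) (y n)) + (fun n => dotv (y n) (y n))).
  apply/funext => n.
  rewrite -[LHS]/(dotv (a *: x n + y n) (a *: x n + y n)).
  rewrite -[RHS]/(a ^+ 2 * dotv (x n) (x n) + 2 * a * dotv (x n) (y n) +
                  dotv (y n) (y n)).
  rewrite dotvP dotvC dotvP (dotvC (y n) (_ + _)) dotvP (dotvC (y n) (x n)).
  by ring.
apply: is_cvg_seriesD => //; apply: is_cvg_seriesD; apply: is_cvg_seriesZ => //.
exact: sqsum_dotv.
Qed.

End SquareSummable.

Record l2 (R : realType) := L2 {
  l2_val :> nat -> 'rV[R]_2;
  _ : [pred x : nat -> 'rV[R]_2 | `[< sqsum x >]] l2_val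
}.

Section L2.
Context (R : realType).
Local Notation P := [pred x : nat -> 'rV[R]_2 | `[< sqsum x >]].

HB.instance Definition _ := [isSub for @l2_val R].
HB.instance Definition _ := [Choice of l2 R by <:].
HB.instance Definition _ := GRing.isSubmodClosed.Build _ _ P (@sqsum_submod R).
HB.instance Definition _ := [SubChoice_isSubLmodule of l2 R by <:].

Implicit Types x y z : l2 R.

Lemma l2P x : sqsum x.
Proof. by case: x => x /= /asboolP. Qed.

Definition l2_dot x y : R := limn (series (fun n => dotv (x n) (y n))).

Lemma l2_dot_cvg x y : cvgn (series (fun n => dotv (x n) (y n))).
Proof. by apply: sqsum_dotv; exact: l2P. Qed.

Lemma l2_dotC x y : l2_dot x y = l2_dot y x.
Proof. by rewrite /l2_dot; under eq_fun do rewrite dotvC. Qed.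

Lemma l2_dotP (a : R) x y z :
  l2_dot (a *: x + y) z = a * l2_dot x z + l2_dot y z.
Proof.
have cxz := @l2_dot_cvg x z; have cyz := @l2_dot_cvg y z.
rewrite /l2_dot -[a * _]/(a *: _) -lim_seriesZ // -lim_seriesD //; last first.
  exact: is_cvg_seriesZ.
by congr (limn (series _)); apply/funext => n; exact: dotvP.
Qed.

Lemma l2_dot0 x : l2_dot 0 x = 0.
Proof. by have := l2_dotP (-1) 0 0 x; rewrite scaler0 addr0 mulN1r addNr. Qed.

Lemma l2_dot_partial x N : \sum_(n < N) dotv (x n) (x n) <= l2_dot x x.
Proof.
rewrite -(big_mkord xpredT (fun n => dotv (x n) (x n))).
apply: nondecreasing_cvgn_le; last exact: l2_dot_cvg.
apply/nondecreasing_seqP => n.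
by rewrite !seriesEnat /= big_nat_recr //= lerDl dotv_ge0.
Qed.

Lemma l2_dot_term x n : dotv (x n) (x n) <= l2_dot x x.
Proof.
apply: le_trans (l2_dot_partial x n.+1); rewrite big_ord_recr /= lerDr.
by apply: sumr_ge0 => i _; exact: dotv_ge0.
Qed.

Lemma l2_dot_ge0 x : 0 <= l2_dot x x.
Proof. by have := l2_dot_partial x 0; rewrite big_ord0. Qed.

Lemma l2_dot_eq0 x : l2_dot x x = 0 -> x = 0.
Proof.
move=> x0; apply/val_inj/funext => n; apply: dotv_eq0; apply/eqP.
by rewrite eq_le dotv_ge0 andbT -x0 l2_dot_term.
Qed.

Lemma l2_bilinear : bilinear_for *%R (idfun \; *%R) l2_dot.
Proof.
split=> [z a x y|z a x y]; first exact: l2_dotP.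
by rewrite l2_dotC l2_dotP !(l2_dotC _ z).
Qed.

HB.instance Definition _ :=
  bilinear_isBilinear.Build R (l2 R) (l2 R) R *%R (idfun \; *%R) l2_dot l2_bilinear.

Lemma l2_hermitian x y : l2_dot x y = (-1) ^+ false * idfun (l2_dot y x).
Proof. by rewrite mul1r l2_dotC. Qed.

HB.instance Definition _ :=
  isHermitianSesquilinear.Build R (l2 R) false idfun l2_dot l2_hermitian.

Lemma l2_definite x : x != 0 -> 0 < l2_dot x x.
Proof.
move=> x0; rewrite lt_def l2_dot_ge0 andbT.
by apply: contra_neq x0; exact: l2_dot_eq0.
Qed.

HB.instance Definition _ := isDotProduct.Build R (l2 R) l2_dot l2_definite.

Definition l2_norm x : R := Num.sqrt (l2_dot x x).

Lemma l2_dot_quad (a : R) x y : l2_dot (a *: x + y) (a *: x + y) =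
  a ^+ 2 * l2_dot x x + 2 * a * l2_dot x y + l2_dot y y.
Proof.
rewrite l2_dotP (l2_dotC x (_ + _)) (l2_dotC y (_ + _)) !l2_dotP.
by rewrite (l2_dotC y x); ring.
Qed.

Lemma l2_CauchySchwarz x y : l2_dot x y ^+ 2 <= l2_dot x x * l2_dot y y.
Proof.
have [->|x0] := eqVneq x 0; first by rewrite !l2_dot0 expr0n mul0r.
have A0 := l2_definite x0.
have := l2_dot_ge0 (- (l2_dot x y / l2_dot x x) *: x + y).
rewrite l2_dot_quad => h.
rewrite -subr_ge0; have := mulr_ge0 (ltW A0) h; congr (0 <= _).
by field; rewrite gt_eqF.
Qed.

Lemma l2_normD x y : l2_norm (x + y) <= l2_norm x + l2_norm y.
Proof.
rewrite -(@ler_pXn2r _ 2) ?nnegrE ?addr_ge0 ?sqrtr_ge0 // sqrrD.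
rewrite /l2_norm !sqr_sqrtr ?l2_dot_ge0 // -{1 2}[x]scale1r l2_dot_quad.
rewrite expr1n mul1r mulr1 lerD2r lerD2l -[leRHS]mulr_natl ler_pM2l //.
rewrite -sqrtrM ?l2_dot_ge0 //; apply: le_trans (ler_norm _) _.
by rewrite -sqrtr_sqr ler_sqrt ?l2_CauchySchwarz // mulr_ge0 ?l2_dot_ge0.
Qed.

Lemma l2_normZ (a : R) x : l2_norm (a *: x) = `|a| * l2_norm x.
Proof.
rewrite /l2_norm -[a *: x]addr0 l2_dot_quad (l2_dotC x) !l2_dot0 mulr0 !addr0.
by rewrite sqrtrM ?sqr_ge0 // sqrtr_sqr.
Qed.

Lemma l2_norm_eq0 x : l2_norm x = 0 -> x = 0.
Proof.
move=> /eqP; rewrite sqrtr_eq0 => x0; apply: l2_dot_eq0.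
by apply/eqP; rewrite eq_le x0 l2_dot_ge0.
Qed.

HB.instance Definition _ :=
  Lmodule_isNormed.Build R (l2 R) l2_normD l2_normZ l2_norm_eq0.

Lemma l2_dotE x : l2_dot x x = `|x| ^+ 2.
Proof. by rewrite /Num.norm /= sqr_sqrtr // l2_dot_ge0. Qed.

HB.instance Definition _ :=
  NormedModule_isInnerProduct.Build R (l2 R) l2_dotE.

Lemma l2_coord_le x n i : `|x n 0 i| <= `|x|.
Proof.
rewrite -(@ler_pXn2r _ 2) ?nnegrE // -l2_dotE real_normK ?num_real //.
exact: le_trans (dotv_coord _ _) (l2_dot_term _ _).
Qed.

Lemma l2_complete (F : set_system (l2 R)) : ProperFilter F -> cauchy F -> cvg F.
Proof.
move=> FF /cauchyP Fc.
pose c n i (x : l2 R) : R := x n 0 i.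
have ccvg n i : cvg (c n i @ F).
  apply: cauchy_cvg; apply/cauchyP => e e0.
  have [x Fx] := Fc e e0; exists (c n i x).
  change (F [set x' | ball (c n i x) e (c n i x')]).
  apply: filterS Fx => x' /=; rewrite -!ball_normE /=; apply: le_lt_trans.
  have -> : c n i x - c n i x' = (x - x') n 0 i by rewrite /c /= !mxE.
  exact: l2_coord_le.
pose y n : 'rV[R]_2 := \row_i lim (c n i @ F).
have key e : 0 < e -> exists2 x : l2 R, F (ball x e) & forall N,
    \sum_(n < N) dotv (x n - y n) (x n - y n) <= e ^+ 2.
  move=> e0; have [x Fx] := Fc e e0; exists x => // N.
  have h : (fun x' : l2 R => \sum_(n < N) dotv (x n - x' n) (x n - x' n)) x' @[x' --> F]
      --> \sum_(n < N) dotv (x n - y n) (x n - y n).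
    apply: cvg_big => [|n _]; first exact: add_continuous.
    apply: cvg_big => [|i _]; first exact: add_continuous.
    rewrite !mxE; under eq_fun do rewrite !mxE.
    by apply: cvgM; apply: cvgB; [exact: cvg_cst|exact: ccvg|exact: cvg_cst|exact: ccvg].
  apply: (cvgr_to_le h); apply: filterS Fx => x'.
  rewrite -ball_normE /= => /ltW xx'; apply: (le_trans (l2_dot_partial (x - x') N)).
  by rewrite l2_dotE ler_pXn2r ?nnegrE // ltW.
have [z zE] : exists z : l2 R, z = y :> (nat -> 'rV[R]_2).
  have [x _ xy] := key 1 ltr01.
  have xyP : P (fun n => x n - y n).
    apply/asboolP; apply: nondecreasing_is_cvgn.
      apply/nondecreasing_seqP => n.
      by rewrite !seriesEnat /= big_nat_recr //= lerDl dotv_ge0.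
    by exists (1 ^+ 2) => _ [N _ <-]; rewrite seriesEnat /= big_mkord.
  exists (x - L2 xyP); apply/funext => n.
  by rewrite -[LHS]/(x n - (x n - y n)) subKr.
apply/cvg_ex; exists z; apply/fcvgrPdist_lt => e e0.
have e20 : 0 < e / 2 by rewrite divr_gt0.
have [x Fx xz] := key _ e20.
apply: filterS Fx => x'; rewrite -ball_normE /= => xx'.
rewrite -(subrK x z) -addrA (le_lt_trans (ler_normD _ _)) //.
rewrite [ltRHS]splitr ler_ltD // distrC.
rewrite -(@ler_pXn2r _ 2) ?nnegrE ?(ltW e20) // -l2_dotE.
apply: limr_le; first exact: l2_dot_cvg.
apply: nearW => N; rewrite seriesEnat /= big_mkord.
apply: le_trans (xz N).
by apply: ler_sum => n _; rewrite -zE.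
Qed.

HB.instance Definition _ := Uniform_isComplete.Build (l2 R) l2_complete.

End L2.

(* Main.v *)
Require Import Defs.
From mathcomp Require Import all_boot all_order all_algebra.
From mathcomp Require Import all_classical all_reals all_analysis.
From mathcomp Require Import ring lra.

(** Since g is half the squared norm, its gradient is the identity, so the
    forward step I - P_V grad(g) P_V is the projection I - P_V onto the
    orthogonal complement of V.  The proximal map of the indicator of U plus
    (a/2) |.|^2 is c P_U with c = 1 / (1 + a).  As I - P_V is killed by P_V, the
    reflection through V acts on its range as -I, and the operator collapses to

      T = (I - c P_U) (I - P_V)                                  ([fdrs_opE]).

    Take for V the vertical line in every block R^2, and for U in block n the
    line spanned by (sin t_n, cos t_n) with sin^2 t_n = 1 / (n + 1).  Then T
    sees only the horizontal coordinate of a block and multiplies it by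
    r_n = 1 - c / (n + 1), so that after k steps the horizontal coordinate of
    block n has been multiplied by r_n ^ k ([fdrs_op_blocks], [iter_coord]).
    The angles are nonzero, hence r_n < 1, U and V meet only in 0 and 0 is the
    only fixed point; but they tend to 0, hence there is no uniform rate.

    Quantitatively, r_n ^ k >= 1 / e as long as k <= n ([expR1N_le_rate]): after
    k steps, every block n >= k has kept at least 1 / e of its size.  So let z^0
    be horizontal, with squared size F(n)^2 - F(n+1)^2 in block n.  These sizes
    telescope: the blocks n >= k carry exactly F(k)^2, and
    |z^k| >= F(k) / e ([iter_lower]).  Conversely, cutting at a block N gives
    |z^(k+1)|^2 <= r_N^(2k) F(0)^2 + F(N)^2 ([iter_upper]): the first term
    vanishes as k grows and the second is small for N large, which is strong
    convergence ([iter_cvg0]). *)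

Set Implicit Arguments.
Unset Strict Implicit.
Unset Printing Implicit Defensive.

Import Order.TTheory GRing.Theory Num.Theory.
Import numFieldNormedType.Exports.

Local Open Scope classical_set_scope.
Local Open Scope ring_scope.

(** * Projections, gradient and proximal map in a Hilbert space *)

Section Hilbert.
Context (R : realType) (H : hilbertType R).
Implicit Types (U V : set H) (x y z p q v : H).

Lemma inner_sym x y : inner x y = inner y x.
Proof. by rewrite hermC /= expr0 mul1r. Qed.

Lemma innerZl (c : R) x y : inner (c *: x) y = c * inner x y.
Proof. exact: linearZl_LR. Qed.

Lemma normD_sqr x y : `|x + y| ^+ 2 = `|x| ^+ 2 + 2 * inner x y + `|y| ^+ 2.
Proof.
rewrite -!inner_norm linearDl /= !linearDr /= (inner_sym y x); ring.
Qed.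

Lemma normB_sqr x y : `|x - y| ^+ 2 = `|x| ^+ 2 - 2 * inner x y + `|y| ^+ 2.
Proof. by rewrite normD_sqr normrN linearNr mulrN. Qed.

(** The bound 2 |<x, h>| <= |x|^2 + |h|^2, which comes from |x + h|^2 >= 0 and
    |x - h|^2 >= 0 and is read on the unit ball, is already enough for a linear form to be bounded. *)
Lemma inner_continuous x : continuous (inner x).
Proof.
apply: bounded_linear_continuous; apply/ex_bound; exists (`|x| ^+ 2 + 1).
near=> h.
have hh : `|h| <= 1 by near: h; apply: nbhs0_le.
have h1 : `|h| ^+ 2 <= 1 by rewrite expr_le1.
have := sqr_ge0 `|x + h|; have := sqr_ge0 `|x - h|.
rewrite normB_sqr normD_sqr => Hm Hp; rewrite /= ler_norml; have := sqr_ge0 `|x|.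
by move=> x0; apply/andP; split; lra.
Unshelve. all: by end_near. Qed.

(** The remainder of the first-order expansion is exactly |h|^2 / 2. *)
Lemma half_sqr_diff x :
  (fun y => 1 / 2 * `|y| ^+ 2) \o shift x = cst (1 / 2 * `|x| ^+ 2) + inner x +o_ 0 id.
Proof.
apply/eqaddoP => e e0; near=> h.
rewrite [X in `|X|](_ : _ = 1 / 2 * `|h| ^+ 2); last first.
  rewrite -[LHS]/(1 / 2 * `|h + x| ^+ 2 - (1 / 2 * `|x| ^+ 2 + inner x h)).
  by rewrite normD_sqr inner_sym; lra.
have he : `|h| <= e by near: h; apply: nbhs0_le.
rewrite ger0_norm; last by rewrite mulr_ge0 ?sqr_ge0.
have h0 := normr_ge0 h; rewrite expr2 mulrA ler_wpM2r //; lra.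
Unshelve. all: by end_near. Qed.

Lemma grad_half_sqr x : grad (fun y => 1 / 2 * `|y| ^+ 2) x = x.
Proof.
have dE : 'd (fun y => 1 / 2 * `|y| ^+ 2 : R^o) x = inner x :> (H -> R^o).
  exact: (@diff_unique _ _ _ _ (inner x : {linear H -> R^o}) _
    (@inner_continuous x) (half_sqr_diff x)).
apply: get_unique => /= [|v [_ vE]].
  split=> [|h]; last by rewrite dE.
  apply/diff_locallyP; rewrite dE; split; first exact: inner_continuous.
  exact: half_sqr_diff.
apply/eqP; rewrite -subr_eq0 -normr_eq0 -sqrf_eq0 -inner_norm linearBl /=.
by rewrite -vE dE subrr.
Qed.

Definition is_proj V x p := V p /\ forall v, V v -> inner (x - p) v = 0.

Section Subspace.
Variable V : set H.
Hypothesis subV : submod_closed [in V].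

Lemma subspace_lin (c : R) x y : V x -> V y -> V (c *: x + y).
Proof.
by case: subV => _ lin Vx Vy; have := lin c x y; rewrite !inE; apply.
Qed.

Lemma subspace0 : V 0.
Proof. by case: subV; rewrite inE. Qed.

Lemma subspaceZ (c : R) x : V x -> V (c *: x).
Proof. by move=> Vx; rewrite -[c *: x]addr0; apply: subspace_lin subspace0. Qed.

Lemma subspaceB x y : V x -> V y -> V (x - y).
Proof. by move=> Vx Vy; rewrite addrC -scaleN1r; apply: subspace_lin. Qed.

Lemma is_proj_id p : V p -> is_proj V p p.
Proof. by split=> // v _; rewrite subrr linear0l. Qed.

Lemma is_projN x p : is_proj V x p -> is_proj V (- x) (- p).
Proof.
case=> Vp xp; split=> [|v Vv]; first by rewrite -scaleN1r; apply: subspaceZ.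
by rewrite -opprD linearNl /= xp ?oppr0.
Qed.

Lemma is_proj_compl x p : is_proj V x p -> is_proj V (x - p) 0.
Proof. by case=> _ xp; split=> [|v Vv]; [exact: subspace0|rewrite subr0 xp]. Qed.

(** Pythagoras; uniqueness of the projection, closedness of the subspace and
    the value of the proximal map are all read off from it. *)
Lemma dist_proj x p y : is_proj V x p -> V y ->
  `|x - y| ^+ 2 = `|x - p| ^+ 2 + `|p - y| ^+ 2.
Proof.
move=> [Vp xp] Vy.
rewrite (_ : x - y = (x - p) + (p - y)); last by rewrite addrA subrK.
rewrite normD_sqr xp ?mulr0 ?addr0 //.
exact: subspaceB.
Qed.

Lemma projE x p : is_proj V x p -> Defs.proj V x = p.
Proof.
move=> xp; apply: get_unique => [//|q xq].
have := dist_proj (xq : is_proj V x q) xp.1; rewrite (dist_proj xp xq.1).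
rewrite (distrC q) -addrA -[LHS]addr0 => /addrI/esym/eqP.
rewrite -mulr2n mulrn_eq0 /= sqrf_eq0 normr_eq0 subr_eq0 => /eqP.
exact: esym.
Qed.

(** A subspace onto which every point can be projected is closed: a limit
    point is at distance 0 from the subspace, hence equal to its projection. *)
Lemma subspace_closed : (forall x, exists p, is_proj V x p) -> closed V.
Proof.
move=> exP x clx; have [p xp] := exP x.
suff /eqP : `|x - p| = 0 by rewrite normr_eq0 subr_eq0 => /eqP ->; case: xp.
apply/eqP/contraT => xp0.
have d0 : 0 < `|x - p| by rewrite lt_def xp0 normr_ge0.
have [y [Vy]] := clx _ (nbhsx_ballx x _ d0).
rewrite -ball_normE /= ltNge -(@ler_pXn2r _ 2) ?nnegrE // (dist_proj xp Vy).
by rewrite lerDl sqr_ge0.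
Qed.

(** Over V, the objective differs from (1 + a) / 2 |y - p / (1 + a)|^2 by a
    constant, because |y - x|^2 and |y - p|^2 do; so the minimizer is unique. *)
Lemma prox_chi_sqr (a : R) x p : 0 <= a -> is_proj V x p ->
  prox 1 (fun y => (chi V y + (a / 2 * `|y| ^+ 2)%:E)%E) x = (1 + a)^-1 *: p.
Proof.
move=> a0 xp; have [Vp xpo] := xp.
set m := _ *: p.
have Vm : V m by apply: subspaceZ.
have a10 : 1 + a != 0 by rewrite gt_eqF //; lra.
have pE : p = (1 + a) *: m by rewrite scalerA divff ?scale1r.
clearbody m.
pose h y := a / 2 * `|y| ^+ 2 + (2 * 1)^-1 * `|y - x| ^+ 2.
have hE y : V y -> h y = h m + (1 + a) / 2 * `|y - m| ^+ 2.
  move=> Vy; rewrite /h (distrC y x) (distrC m x) (dist_proj xp Vy) (dist_proj xp Vm).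
  rewrite !normB_sqr pE !innerZl inner_norm (inner_sym y m).
  by field.
have fE y : V y -> (chi V y + (a / 2 * `|y| ^+ 2)%:E +
    ((2 * 1)^-1 * `|y - x| ^+ 2)%:E = (h y)%:E)%E.
  by move=> Vy; rewrite /chi mem_set // add0e -EFinD.
apply: get_unique => [|y] /=.
  move=> y; rewrite (fE _ Vm); have [Vy|nVy] := pselect (V y).
    rewrite fE // lee_fin (hE _ Vy) lerDl mulr_ge0 ?sqr_ge0 //; lra.
  by rewrite /chi memNset // leey.
move=> /(_ m); rewrite (fE _ Vm); have [Vy|nVy] := pselect (V y); last first.
  by rewrite /chi memNset.
rewrite fE // lee_fin (hE _ Vy) => ym.
apply/eqP; rewrite -subr_eq0 -normr_eq0 -sqrf_eq0.
have := sqr_ge0 `|y - m|; rewrite le_eqVlt => /orP[/eqP<- //|y0].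
suff : 0 < (1 + a) / 2 * `|y - m| ^+ 2 by lra.
by rewrite mulr_gt0 //; lra.
Qed.

End Subspace.

(** The forward step gives w = z - p, which
    is orthogonal to V, so its reflection through V is - w. *)
Lemma fdrs_opE (a : R) U V z p q : 0 <= a ->
  submod_closed [in U] -> submod_closed [in V] ->
  is_proj V z p -> is_proj U (z - p) q ->
  fdrs_op 1 (fun x => (chi U x + (a / 2 * `|x| ^+ 2)%:E)%E)
    (fun x => 1 / 2 * `|x| ^+ 2) V z = z - p - (1 + a)^-1 *: q.
Proof.
move=> a0 subU subV zp wq; rewrite /fdrs_op (projE subV zp) grad_half_sqr.
rewrite (projE subV (is_proj_id zp.1)) scale1r /refl_proj.
rewrite (projE subV (is_proj_compl subV zp)) scaler0 /refl_prox.
rewrite sub0r (prox_chi_sqr subU a0 (is_projN subU wq)) opprK.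
move: (z - p) => w; rewrite scalerDr addrCA -scalerDl scalerA mulVf //.
rewrite (_ : 2^-1 + 2^-1 = 1); last by field.
by rewrite !scale1r scalerN addrC.
Qed.

End Hilbert.

(** * Blockwise lines in l2 *)

Section Blocks.
Context (R : realType).
Implicit Types (x y p : l2 R) (u : nat -> 'rV[R]_2).

Definition vec2 (s t : R) : 'rV[R]_2 := \row_i [:: s; t]`_i.

Lemma dotv_vec2 s t s' t' : dotv (vec2 s t) (vec2 s' t') = s * s' + t * t'.
Proof. by rewrite /dotv !big_ord_recl big_ord0 addr0 !mxE. Qed.

Lemma vec2E (v : 'rV[R]_2) : v = vec2 (v 0 0) (v 0 1).
Proof.
apply/rowP => i; rewrite mxE.
by case: i => [[|[|//]] ?] /=; congr (v _ _); apply: val_inj.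
Qed.

Lemma dotvZl (c : R) (v w : 'rV[R]_2) : dotv (c *: v) w = c * dotv v w.
Proof. by rewrite /dotv mulr_sumr; apply: eq_bigr => i _; rewrite mxE mulrA. Qed.

Lemma dotvZr (c : R) (v w : 'rV[R]_2) : dotv v (c *: w) = c * dotv v w.
Proof. by rewrite dotvC dotvZl dotvC. Qed.

Lemma dotvBl (v v' w : 'rV[R]_2) : dotv (v - v') w = dotv v w - dotv v' w.
Proof. by rewrite addrC -scaleN1r dotvP mulN1r addrC. Qed.

Lemma dotvBr (v w w' : 'rV[R]_2) : dotv v (w - w') = dotv v w - dotv v w'.
Proof. by rewrite dotvC dotvBl !(dotvC v). Qed.

Lemma normE2_le x (B : R) :
  (forall N, \sum_(n < N) dotv (x n) (x n) <= B) -> `|x| ^+ 2 <= B.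
Proof.
move=> xB; rewrite -l2_dotE; apply: limr_le; first exact: l2_dot_cvg.
by apply: nearW => N; rewrite seriesEnat /= big_mkord.
Qed.

Lemma l2_of_bounded (v : nat -> 'rV[R]_2) (B : R) :
  (forall N, \sum_(n < N) dotv (v n) (v n) <= B) -> exists x, forall n, x n = v n.
Proof.
move=> vB.
have vP : [pred x : nat -> 'rV[R]_2 | `[< sqsum x >]] v.
  apply/asboolP; apply: nondecreasing_is_cvgn.
    apply/nondecreasing_seqP => n.
    by rewrite !seriesEnat /= big_nat_recr //= lerDl dotv_ge0.
  by exists B => _ [N _ <-]; rewrite seriesEnat /= big_mkord.
by exists (L2 vP).
Qed.

Definition block_lines u : set (l2 R) := [set x | forall n, exists c, x n = c *: u n].

Lemma block_lines_submod u : submod_closed [in block_lines u].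
Proof.
split=> [|c x y]; rewrite !inE.
  by move=> n; exists 0; rewrite scale0r.
move=> xu yu n; have [d xE] := xu n; have [e yE] := yu n; exists (c * d + e).
by rewrite -[LHS]/(c *: x n + y n) xE yE scalerA scalerDl.
Qed.

(** With unit directions, projecting each block onto its line does not increase
    the norm of the block, which keeps the result square summable. *)
Lemma block_lines_proj u x : (forall n, dotv (u n) (u n) = 1) ->
  exists p, is_proj (block_lines u) x p /\
            forall n, p n = dotv (x n) (u n) *: u n.
Proof.
move=> u1.
have [|p pE] := @l2_of_bounded (fun n => dotv (x n) (u n) *: u n) (l2_dot x x).
  move=> N; apply: le_trans (l2_dot_partial x N); apply: ler_sum => n _.
  rewrite /= dotvZl dotvZr u1 mulr1.
  have := dotv_ge0 (x n - dotv (x n) (u n) *: u n).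
  rewrite dotvBl !dotvBr !dotvZl !dotvZr u1 (dotvC (u n)); lra.
exists p; split=> //; split=> [n|v vu]; first by exists (dotv (x n) (u n)).
rewrite -[LHS]/(l2_dot (x - p) v) /l2_dot.
rewrite (_ : (fun _ => _) = fun=> 0); last first.
  apply/funext => n; have [c ->] := vu n; rewrite dotvZr.
  by rewrite -[X in dotv X]/(x n - p n) dotvBl pE dotvZl u1 mulr1 subrr mulr0.
rewrite (_ : series _ = fun=> 0) ?lim_cst //.
by apply/funext => N; rewrite /series /= big1.
Qed.

Lemma block_lines_closed u : (forall n, dotv (u n) (u n) = 1) ->
  closed_subspace (block_lines u).
Proof.
move=> u1; split; last exact: block_lines_submod.
apply: subspace_closed (@block_lines_submod u) _ => x.
by have [p []] := block_lines_proj x u1; exists p.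
Qed.

End Blocks.

(** * Telescoping bounds and the contraction rate *)

Section Bounds.
Context (R : realType).
Implicit Types (x h : nat -> R).

Lemma ler_sum_telescope x h : (forall n, x n <= h n - h n.+1) ->
  forall N, \sum_(n < N) x n <= h 0 - h N.
Proof.
move=> xh; elim=> [|N IH]; first by rewrite big_ord0 subrr.
rewrite big_ord_recr /=; have := xh N; lra.
Qed.

Lemma sum_telescope_ler x h : (forall n, h n - h n.+1 <= x n) ->
  forall N, h 0 - h N <= \sum_(n < N) x n.
Proof.
move=> xh; elim=> [|N IH]; first by rewrite big_ord0 subrr.
rewrite big_ord_recr /=; have := xh N; lra.
Qed.

(** Since c <= 1, the base is at least n / (n + 1) = 1 / (1 + 1 / n), which is
    at least exp(- 1 / n) by 1 + x <= exp x; and k / n <= 1. *)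
Lemma expR1N_le_rate (c : R) (n k : nat) : 0 <= c <= 1 -> (k <= n)%N ->
  expR (- 1) <= (1 - c / n.+1%:R) ^+ k.
Proof.
move=> /andP[c0 c1] kn; have [n0|n0] := posnP n.
  by move: kn; rewrite n0 leqn0 => /eqP ->; rewrite expr0 expR_le1 oppr_le0.
have n0R : 0 < n%:R :> R by rewrite ltr0n.
have n1R : 0 < n.+1%:R :> R by rewrite ltr0n.
have base : expR (- n%:R^-1) <= 1 - c / n.+1%:R.
  apply: (@le_trans _ _ (n%:R / n.+1%:R)).
    rewrite expRN -invf_div lef_pV2 ?posrE ?expR_gt0 ?divr_gt0 //.
    apply: le_trans (expR_ge1Dx _); rewrite -natr1 mulrDl divff ?mul1r //.
    by rewrite gt_eqF.
  rewrite ler_pdivrMr // mulrBl mul1r divfK ?gt_eqF //.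
  by rewrite -natr1; lra.
apply: (@le_trans _ _ (expR (- n%:R^-1) ^+ k)); last first.
  by rewrite lerXn2r ?nnegrE ?expR_ge0 // (le_trans _ base) ?expR_ge0.
rewrite -expRM_natl ler_expR mulrN lerN2 ler_pdivrMr // mul1r ler_nat //.
Qed.

End Bounds.

(** * The two families of lines and the iteration *)

Section Construction.
Context (R : realType) (c : R).
Hypothesis c01 : 0 < c <= 1.

Definition sine (n : nat) : R := Num.sqrt n.+1%:R^-1.
Definition cosine (n : nat) : R := Num.sqrt (1 - n.+1%:R^-1).

Definition slopes (n : nat) := vec2 (sine n) (cosine n).
Definition rate (n : nat) : R := 1 - c / n.+1%:R.

Lemma sine_gt0 n : 0 < sine n. Proof. by rewrite sqrtr_gt0 invr_gt0 ltr0n. Qed.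

Lemma sine_sqr n : sine n ^+ 2 = n.+1%:R^-1.
Proof. by rewrite sqr_sqrtr // invr_ge0 ler0n. Qed.

Lemma cosine_sqr n : cosine n ^+ 2 = 1 - n.+1%:R^-1.
Proof. by rewrite sqr_sqrtr // subr_ge0 invf_le1 ?ltr0n // ler1n. Qed.

Lemma slopes_unit n : dotv (slopes n) (slopes n) = 1.
Proof. by rewrite dotv_vec2 -!expr2 sine_sqr cosine_sqr addrC subrK. Qed.

Lemma vertical_unit (n : nat) : dotv (vec2 0 1 : 'rV[R]_2) (vec2 0 1) = 1.
Proof. by rewrite dotv_vec2; ring. Qed.

Let U := block_lines slopes.
Let V := block_lines (fun=> vec2 0 1 : 'rV[R]_2).

Lemma lines_meet0 : U `&` V = [set 0].
Proof.
apply/seteqP; split=> [x [/= xU xV]|_ ->]; last first.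
  by split; apply: subspace0 (block_lines_submod _).
apply/val_inj/funext => n; have [d xd] := xU n; have [e xe] := xV n.
have : x n 0 0 = x n 0 0 by [].
rewrite {1}xd xe !mxE /= mulr0 => /eqP; rewrite mulf_eq0 (gt_eqF (sine_gt0 n)) orbF.
by move=> /eqP d0; rewrite [LHS]xd d0 scale0r.
Qed.

Lemma rate_ge0 n : 0 <= rate n.
Proof.
case/andP: c01 => c0 c1.
by rewrite subr_ge0 ler_pdivrMr ?ltr0n // mul1r (le_trans c1) // ler1n.
Qed.

Lemma rate_lt1 n : rate n < 1.
Proof. by case/andP: c01 => c0 _; rewrite gtrBl divr_gt0 ?ltr0n. Qed.

Lemma rate_le m n : (m <= n)%N -> rate m <= rate n.
Proof.
move=> mn; case/andP: c01 => c0 _; rewrite lerD2l lerN2 ler_pM2l //.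
by rewrite lef_pV2 ?posrE ?ltr0n // ler_nat.
Qed.

(** The image under (I - c P_U) (I - P_V) of the horizontal unit vector of
    block n. *)
Definition direction n := vec2 (rate n) (- (c * sine n * cosine n)).

(** Both factors of (I - c P_U) (I - P_V) are nonexpansive. In coordinates,
    with w = sin^2 t_n, the squared norm is 1 - c w (2 - c). *)
Lemma direction_le1 n : dotv (direction n) (direction n) <= 1.
Proof.
case/andP: c01 => c0 c1.
rewrite dotv_vec2 mulrNN -!expr2 !exprMn sine_sqr cosine_sqr /rate.
have : 0 < n.+1%:R^-1 :> R by rewrite invr_gt0 ltr0n.
move: (_^-1) => w w0.
have -> : (1 - c * w) ^+ 2 + c ^+ 2 * w * (1 - w) = 1 - c * w * (2 - c) by ring.
by rewrite gerBl !mulr_ge0 ?ltW //; lra.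
Qed.

(** The iteration uses only the blockwise form of the operator and a nonnegative
    sequence b, decreasing to 0, whose squared increments are the squared sizes
    of the blocks of the starting point. *)
Section Iteration.
Variable T : l2 R -> l2 R.
Hypothesis TE : forall x n, T x n = x n 0 0 *: direction n.

Lemma fixpoint0 x : T x = x <-> x = 0.
Proof.
split=> [xT|->]; last first.
  by apply/val_inj/funext => n; rewrite [LHS]TE mxE scale0r.
apply/val_inj/funext => n; rewrite [RHS]/(0 : 'rV[R]_2).
have := TE x n; rewrite xT => xn.
have /eqP : x n 0 0 * (1 - rate n) = 0.
  by rewrite mulrBr mulr1 {1}xn !mxE /= subrr.
rewrite mulf_eq0 subr_eq0 (gt_eqF (rate_lt1 n)) orbF => /eqP x0.
by rewrite [LHS]xn x0 scale0r.
Qed.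

Variables (b : nat -> R) (z : nat -> l2 R).
Hypothesis b_ge0 : forall n, 0 <= b n.
Hypothesis b_decr : forall n, b n.+1 <= b n.
Hypothesis b_cvg0 : b n @[n --> \oo] --> 0.
Hypothesis z0E : forall n, z 0%N n = Num.sqrt (b n ^+ 2 - b n.+1 ^+ 2) *: vec2 1 0.
Hypothesis zS : forall k, z k.+1 = T (z k).

Lemma drop_ge0 n : 0 <= b n ^+ 2 - b n.+1 ^+ 2.
Proof. by rewrite subr_ge0 lerXn2r ?nnegrE. Qed.

Lemma iter_coord k n :
  z k n 0 0 = Num.sqrt (b n ^+ 2 - b n.+1 ^+ 2) * rate n ^+ k.
Proof.
elim: k => [|k IH]; first by rewrite z0E !mxE.
by rewrite zS TE !mxE /= IH (exprSr (rate n)) mulrA.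
Qed.

Lemma iter_coord_sqr k n :
  z k n 0 0 ^+ 2 = (b n ^+ 2 - b n.+1 ^+ 2) * rate n ^+ k ^+ 2.
Proof. by rewrite iter_coord exprMn sqr_sqrtr ?drop_ge0. Qed.

(** Up to the factor e^-2, the blocks k, ..., N - 1 of the k-th iterate carry at
    least b_k^2 - b_N^2, and N is arbitrary. *)
Lemma iter_lower k : expR (- 1) * b k <= `|z k|.
Proof.
rewrite -(@ler_pXn2r _ 2) ?nnegrE // ?mulr_ge0 ?expR_ge0 //.
(* The maximum makes the increments of h vanish for n < k, where the blocks
   are just discarded. *)
pose h n := expR (- 1) ^+ 2 * b (maxn n k) ^+ 2.
have hz N : h 0%N - h N <= `|z k| ^+ 2.
  rewrite -l2_dotE; apply: le_trans (l2_dot_partial (z k) N).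
  apply: (@sum_telescope_ler _ (fun n => dotv (z k n) (z k n)) h) => n.
  apply: le_trans (dotv_coord (z k n) 0); rewrite iter_coord_sqr /h.
  have [nk|kn] := ltnP n k.
        rewrite (maxn_idPr nk) subrr.
    by rewrite mulr_ge0 ?sqr_ge0 ?drop_ge0.
  rewrite (maxn_idPl (leqW kn)) -mulrBr mulrC ler_wpM2l ?drop_ge0 //.
  apply: lerXn2r; rewrite ?nnegrE ?expR_ge0 ?exprn_ge0 ?rate_ge0 //.
  by apply: expR1N_le_rate kn; case/andP: c01 => /ltW -> ->.
have hcvg : h 0%N - h N @[N --> \oo] --> h 0%N - 0.
  apply: cvgB; first exact: cvg_cst.
  rewrite -[X in _ --> X](mulr0 (expR (- 1) ^+ 2)); apply: cvgMr.
  apply: (@cvg_trans _ (b n ^+ 2 @[n --> \oo])).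
    apply: near_eq_cvg; near=> n; rewrite (maxn_idPl _) //.
    by near: n; exists k.
  by rewrite -(mulr0 0); under eq_fun do rewrite expr2; exact: (cvgM b_cvg0 b_cvg0).
rewrite exprMn -[b k](congr1 b (max0n k)) -[X in X <= _]subr0.
by apply: (cvgr_to_le hcvg); apply: nearW.
Unshelve. all: by end_near. Qed.

(** Blocks before N have contracted at least at the rate of block N; blocks from
    N on are bounded by their initial sizes, which add up to b_N^2. *)
Lemma iter_upper k N : `|z k.+1| ^+ 2 <= rate N ^+ k ^+ 2 * b 0%N ^+ 2 + b N ^+ 2.
Proof.
(* The first summand pays for the blocks before N; the second one is constant
   there and pays for the blocks from N on. *)
pose h n := rate N ^+ k ^+ 2 * b n ^+ 2 + b (maxn n N) ^+ 2.
have -> : rate N ^+ k ^+ 2 * b 0%N ^+ 2 + b N ^+ 2 = h 0%N by rewrite /h max0n.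
have h_ge0 n : 0 <= h n by rewrite /h addr_ge0 ?sqr_ge0 // mulr_ge0 ?sqr_ge0.
apply: normE2_le => M; apply: (@le_trans _ _ (h 0%N - h M)); last by rewrite gerBl.
apply: (@ler_sum_telescope _ (fun n => dotv (z k.+1 n) (z k.+1 n)) h) => n.
rewrite zS TE dotvZl dotvZr mulrA -expr2.
apply: le_trans (ler_piMr (sqr_ge0 _) (direction_le1 n)) _.
rewrite iter_coord_sqr /h; have dn := drop_ge0 n.
have [nN|Nn] := ltnP n N.
  rewrite (maxn_idPr nN) opprD addrACA subrr addr0 -mulrBr.
  rewrite mulrC ler_wpM2r // !lerXn2r ?nnegrE ?exprn_ge0 ?rate_ge0 //.
  exact/rate_le/ltnW.
rewrite (maxn_idPl (leqW Nn)) opprD addrACA -mulrBr.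
have r1 : rate n ^+ k ^+ 2 <= 1.
  by rewrite !exprn_ile1 ?exprn_ge0 ?rate_ge0 // ltW ?rate_lt1.
by apply: (le_trans (ler_piMr dn r1)); rewrite lerDr mulr_ge0 ?sqr_ge0.
Qed.

Lemma iter_cvg0 : z k @[k --> \oo] --> 0.
Proof.
apply/cvgr0Pnorm_le => e e0.
have [N _ /(_ _ (leqnn N)) bN] : \forall n \near \oo, `|b n| <= e / 2.
  by move/cvgr0Pnorm_le : b_cvg0; apply; lra.
have qcvg : rate N ^+ k ^+ 2 * b 0%N ^+ 2 @[k --> \oo] --> 0.
  rewrite -(mul0r (b 0%N ^+ 2)); apply: cvgMl.
  rewrite -(mulr0 0); under eq_fun do rewrite expr2.
  have : `|rate N| < 1 by rewrite ger0_norm ?rate_ge0 ?rate_lt1.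
  by move=> /cvg_expr r0; exact: (cvgM r0 r0).
have [K _ qK] : \forall k \near \oo, `|rate N ^+ k ^+ 2 * b 0%N ^+ 2| <= e ^+ 2 / 2.
  by move/cvgr0Pnorm_le : qcvg; apply; rewrite divr_gt0 ?exprn_gt0.
exists K.+1 => // -[//|k] /= Kk.
rewrite -(@ler_pXn2r _ 2) ?nnegrE ?(ltW e0) //.
apply: le_trans (iter_upper k N) _.
have := qK k Kk; rewrite ger0_norm; last by rewrite mulr_ge0 ?sqr_ge0.
move=> q2.
have bb : b N ^+ 2 <= (e / 2) ^+ 2.
  by rewrite lerXn2r ?nnegrE // ?(le_trans (ler_norm _) bN) // divr_ge0 // ltW.
move: q2 bb; rewrite exprMn; have := sqr_ge0 e; nra.
Qed.

End Iteration.

End Construction.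

(** * The operator on blocks, and the theorem *)

Section BlockOperator.
Context (R : realType) (a : R).
Hypothesis a_ge0 : 0 <= a.

Lemma fdrs_op_blocks (x : l2 R) n :
  fdrs_op 1 (fun y => (chi (block_lines (@slopes R)) y + (a / 2 * `|y| ^+ 2)%:E)%E)
    (fun y => 1 / 2 * `|y| ^+ 2) (block_lines (fun=> vec2 0 1)) x n =
  x n 0 0 *: direction (1 + a)^-1 n.
Proof.
have [p [xp pE]] := block_lines_proj x (@vertical_unit R).
have [q [wq qE]] := block_lines_proj (x - p) (@slopes_unit R).
rewrite (fdrs_opE a_ge0 (block_lines_submod _) (block_lines_submod _) xp wq).
rewrite -[LHS]/(x n - p n - (1 + a)^-1 *: q n) qE -[(x - p) n]/(x n - p n) pE.
(* With the rate written as 1 - c sin^2, the identity is polynomial in the sine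
   and the cosine. *)
rewrite /slopes /direction /rate -(sine_sqr R n).
move: (sine R n) (cosine R n) => s t.
rewrite [x n]vec2E; move: (x n 0 0) (x n 0 1) => x0 x1.
rewrite dotvBl dotvZl !dotv_vec2.
by apply/rowP => i; rewrite !mxE; case: i => [[|[|//]] ?] /=; ring.
Qed.

End BlockOperator.

Theorem theorem6p5 (R : realType) (a : R) (a_ge0 : 0 <= a) (F : R -> R)
    (F_range : forall t : R, 0 <= t -> 0 < F t < 1)
    (F_decr : forall s t : R, 0 <= s -> s < t -> F t < F s)
    (F_cvg0 : F t @[t --> +oo] --> 0)
    (F_inv : [set (j.+1%:R)^-1 | j in [set j : nat | j != 0%N]] `<=`
             F @` [set t : R | 0 <= t]) :
  exists (z0 : l2 R) (U V : set (l2 R)),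
    [/\ closed_subspace U, closed_subspace V, U `&` V = [set 0] &
      let f := fun x : l2 R => (chi U x + (a / 2 * `|x| ^+ 2)%:E)%E in
      let g := fun x : l2 R => 1 / 2 * `|x| ^+ 2 in
      let T := fdrs_op 1 f g V in
      let z := fdrs_seq 1 f g V (fun=> 1) z0 in
      let zstar := 0 : l2 R in
      [/\ z k @[k --> \oo] --> (0 : l2 R),
          (forall x : l2 R, T x = x <-> x = zstar) &
          forall k : nat, (1 <= k)%N ->
            `|z k - zstar| >= expR (- 1) * F k%:R]].
Proof.
pose c := (1 + a)^-1.
have c01 : 0 < c <= 1 by rewrite invr_gt0 invf_le1; lra.
pose b n := F n%:R.
have b_ge0 n : 0 <= b n by have /andP[/ltW] := F_range n%:R (ler0n _ _).
have b_decr n : b n.+1 <= b n.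
  by apply/ltW/F_decr; rewrite ?ler0n ?ltr_nat.
have b_cvg0 : b n @[n --> \oo] --> 0 by apply: cvg_comp F_cvg0; exact: cvgr_idn.
have [|z0 z0E] := @l2_of_bounded R
    (fun n => Num.sqrt (b n ^+ 2 - b n.+1 ^+ 2) *: vec2 1 0) (b 0%N ^+ 2).
  move=> N; apply: (@le_trans _ _ (b 0%N ^+ 2 - b N ^+ 2)).
    pose v n := Num.sqrt (b n ^+ 2 - b n.+1 ^+ 2) *: vec2 1 0.
    apply: (@ler_sum_telescope _ (fun n => dotv (v n) (v n)) (fun n => b n ^+ 2)).
    move=> n; rewrite /v.
    rewrite dotvZl dotvZr dotv_vec2 mulr0 addr0 !mulr1 -expr2 sqr_sqrtr //.
    exact: drop_ge0.
  by rewrite gerBl sqr_ge0.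
exists z0, (block_lines (@slopes R)), (block_lines (fun=> vec2 0 1)); split.
- exact/block_lines_closed/slopes_unit.
- exact/block_lines_closed/vertical_unit.
- exact: lines_meet0.
move=> f g T z zstar.
have TE x n : T x n = x n 0 0 *: direction c n by exact: fdrs_op_blocks.
have zS k : z k.+1 = T (z k).
  by rewrite /z /= subrr scale0r add0r scale1r.
split.
- exact: (iter_cvg0 c01 TE b_ge0 b_decr b_cvg0 z0E zS).
- exact: (fixpoint0 c01 TE).
- by move=> k _; rewrite subr0; exact: (iter_lower c01 TE b_ge0 b_decr b_cvg0 z0E zS k).
Qed.
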